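(* Let $X$ and $Y$ be random integers with an arbitrary joint distribution on $\{1,\ldots,N\}\times\{1,\ldots,N\}$ (not necessarily independent or uniform). If $H(X,Y\mid X\cdot Y) = 0$, then $$2\log_2 N - H(X,Y) = \Omega(\log\log N).$$ That is, there exist constants $c > 0$ and $N_0$ such that for every $N \ge N_0$ and every pair $(X,Y)$ of random variables taking values in $\{1,\ldots,N\}\times\{1,\ldots,N\}$ with $H(X,Y\mid X\cdot Y)=0$, one has $2\log_2 N - H(X,Y) \ge c\log\log N$.
   Context: $X \cdot Y$ denotes the ordinary integer product. $H$ denotes Shannon entropy with logarithms to base 2. $H(X,Y\mid X\cdot Y)$ is the conditional entropy (equivocation) of the ordered pair $(X,Y)$ given the product $X\cdot Y$; since $X \cdot Y$ is determined by $(X,Y)$, it equals $H(X,Y) - H(X\cdot Y)$. *)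

(* Defs.v *)
From HB Require Import structures.
From mathcomp Require Import all_boot all_order all_algebra.
From mathcomp Require Import all_classical all_reals all_analysis.

Set Implicit Arguments.
Unset Strict Implicit.
Unset Printing Implicit Defensive.

Import Order.TTheory GRing.Theory Num.Theory.

Local Open Scope classical_set_scope.
Local Open Scope ring_scope.

Definition log2 (R : realType) (x : R) : R := ln x / ln 2.

(* Since [ln 0 = 0], terms with [p v = 0] contribute 0; for a probability
   mass function all terms are nonnegative, so the [esum] is the true sum. *)
Definition mass_entropy (R : realType) (V : choiceType) (p : V -> R) : \bar R :=
  \esum_(v in [set: V]) (- (p v * log2 (p v)))%:E.

(* The library's [pmf] is restricted to real-valued random variables. *)
Definition mass (R : realType) (d : measure_display) (T : measurableType d)
    (P : probability T R) (V : choiceType) (Z : T -> V) (v : V) : R :=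
  fine (P (Z @^-1` [set v])).

Definition cond_mass (R : realType) (d : measure_display)
    (T : measurableType d) (P : probability T R) (V W : choiceType)
    (Z : T -> V) (U : T -> W) (u : W) (v : V) : R :=
  fine (P (Z @^-1` [set v] `&` U @^-1` [set u])) / mass P U u.

Definition entropy (R : realType) (d : measure_display) (T : measurableType d)
    (P : probability T R) (V : choiceType) (Z : T -> V) : \bar R :=
  mass_entropy (mass P Z).

(* H(Z | U) = \sum_u P(U = u) H(Z | U = u); values u of probability 0
   contribute 0. *)
Definition cond_entropy (R : realType) (d : measure_display)
    (T : measurableType d) (P : probability T R) (V W : choiceType)
    (Z : T -> V) (U : T -> W) : \bar R :=
  \esum_(u in [set: W])
    ((mass P U u)%:E * mass_entropy (cond_mass P Z U u))%E.

(* Main.v *)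
Require Import Defs.
From mathcomp Require Import all_boot all_order all_algebra.
From mathcomp Require Import all_classical all_reals all_analysis.
From mathcomp Require Import zify ring lra.

Import Order.TTheory GRing.Theory Num.Theory.

(** If the product determines the pair, then the product map is injective on
    the set S of pairs of positive probability
    ([cond_entropy0_injective]), and H(X,Y) <= log2 |S| by Gibbs' inequality
    ([entropy_le_log2_size]).  What remains is a weak form of Erdos'
    multiplication table theorem: a set S of pairs in {1..N}^2 with distinct
    products has at most N^2 / (log N)^c elements, up to a constant
    ([injective_product_le]).

    The reason is that the number omega of distinct prime factors is
    typically log log N for x and for y, hence about 2 log log N for xy,
    whereas an integer up to N^2 typically has only log log N of them.  Write
    L = ln N and fix a threshold K.  A pair (x, y) either has a large gcd,
    which is rare, or has omega x + omega y < K, or has a product n with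
    2^omega(n) at least nearly 2^K ([one_le_cover]).
    - As 2^omega(n) is at most the number tau n of divisors, and the tau n
      with n <= N^2 add up to O(N^2 L), there are O(N^2 L / 2^K) products of
      the last kind ([sum_tau]); distinct pairs of S have distinct products.
    - The sum of (2/3)^omega(n) over n <= N is O(N L^(-1/3))
      ([sum_wt_omega_cube]), so O((3/2)^K N^2 L^(-2/3)) pairs are of the
      second kind.
    With 2^K slightly larger than L the first bound saves a power of L, and so
    does the second, since (3/2)^(log2 L) = L^0.585 and 0.585 < 2/3.

    The bound on the sum of (2/3)^omega(n) replaces Mertens' theorems by two
    elementary devices.  Writing ln n as a sum of von Mangoldt's function over
    the divisors of n and using Chebyshev's psi(x) = O(x), one reduces it to a
    bound O(L^(2/3)) for the sum of (2/3)^omega(n) / n.  Here omega may be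
    replaced by the number Omega of prime factors with multiplicity
    ([sum_wt_omega_inv_le]), and then the bound holds because the three-fold
    Dirichlet convolution of the completely multiplicative function
    (2/3)^Omega is at most tau ([tau3_le]): the cube of the sum of
    (2/3)^Omega(n) / n is at most the sum of tau n / n over
    n <= N^3, which is O(L^2). *)

Local Open Scope nat_scope.

(** * Arithmetic functions and sums over divisors *)

Lemma prime_power_ind (P : nat -> Prop) :
    P 1 ->
    (forall p k m, prime p -> 0 < k -> 0 < m -> ~~ (p %| m) -> P m ->
       P (p ^ k * m)) ->
  forall n, 0 < n -> P n.
Proof.
move=> P1 PM; elim/ltn_ind => n IH n0.
have [n1|n1] := leqP n 1; first by have -> : n = 1 by lia.
have pp := pdiv_prime n1; have [m pm nE] := pfactor_coprime pp n0.
have k0 : 0 < logn (pdiv n) n by rewrite logn_gt0 mem_primes pp n0 pdiv_dvd.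
have m0 : 0 < m by move: n0; rewrite nE muln_gt0 => /andP[].
rewrite nE mulnC; apply: PM => //; first by rewrite -prime_coprime.
apply: IH => //; rewrite [X in _ < X]nE ltn_Pmulr //.
by rewrite -[1](expn0 (pdiv n)) ltn_exp2l // prime_gt1.
Qed.

(** Every multiplicative identity below is read off from this enumeration. *)
Lemma divisors_pfactor p k m : prime p -> 0 < m -> ~~ (p %| m) ->
  perm_eq (divisors (p ^ k * m))
          [seq p ^ j * e | j <- iota 0 k.+1, e <- divisors m].
Proof.
move=> pp m0 pNm; have p0 := prime_gt0 pp.
have pk0 j : 0 < p ^ j by rewrite expn_gt0 p0.
have cop e j : e \in divisors m -> coprime (p ^ j) e.
  rewrite -dvdn_divisors // => em; apply: coprimeXl.
  by rewrite prime_coprime //; apply: contra pNm => /dvdn_trans; apply.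
apply: uniq_perm; first exact: divisors_uniq.
  apply: allpairs_uniq; [exact: iota_uniq|exact: divisors_uniq|].
  move=> [i e] [j f] /allpairsPdep[i1 [e1 [_ e1m [-> ->]]]].
  move=> /allpairsPdep[j1 [f1 [_ f1m [-> ->]]]] /= eqm.
  have e0 : 0 < e1 by move: e1m; rewrite -dvdn_divisors // => /dvdn_gt0; apply.
  have f0 : 0 < f1 by move: f1m; rewrite -dvdn_divisors // => /dvdn_gt0; apply.
  have ln g i' : g \in divisors m -> logn p (p ^ i' * g) = i'.
    move=> gm; have := cop _ 1 gm; rewrite expn1 => pg.
    by rewrite mulnC logn_Gauss // pfactorK.
  have ij : i1 = j1 by rewrite -(ln e1 i1 e1m) eqm ln.
  by move: eqm; rewrite ij => /eqP; rewrite eqn_pmul2l // => /eqP ->.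
move=> d; rewrite -dvdn_divisors ?muln_gt0 ?pk0 //.
apply/idP/allpairsPdep => [dv|[j [e [jk em ->]]]]; last first.
  rewrite -dvdn_divisors // in em; rewrite dvdn_mul // dvdn_exp2l //.
  by move: jk; rewrite mem_iota; lia.
have d0 : 0 < d by apply: dvdn_gt0 dv; rewrite muln_gt0 pk0.
have [e pe dE] := pfactor_coprime pp d0.
have em : e %| m.
  rewrite -(@Gauss_dvdr _ (p ^ k)); last first.
    by rewrite coprime_sym coprimeXl.
  by apply: dvdn_trans dv; rewrite [X in _ %| X]dE dvdn_mulr.
exists (logn p d), e; rewrite -dvdn_divisors // em mem_iota; split => //.
  rewrite add0n ltnS leq0n /= -(dvdn_Pexp2l _ _ (prime_gt1 pp)).
  have : p ^ logn p d %| p ^ k * m by apply: dvdn_trans dv; exact: pfactor_dvdnn.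
  by rewrite Gauss_dvdl // coprimeXl // prime_coprime.
by rewrite [LHS]dE mulnC.
Qed.

Lemma big_divisors_pfactor (V : nmodType) (F : nat -> V) p k m :
    prime p -> 0 < m -> ~~ (p %| m) ->
  (\sum_(d <- divisors (p ^ k * m)) F d =
   \sum_(0 <= j < k.+1) \sum_(e <- divisors m) F (p ^ j * e)%N)%R.
Proof.
move=> pp m0 pNm; rewrite (perm_big _ (divisors_pfactor _ k _ pp m0 pNm)).
by rewrite big_allpairs_dep /index_iota subn0.
Qed.

Lemma big_divisors_le (V : nmodType) (F : nat -> V) x n : 0 < n <= x ->
  (\sum_(d <- divisors n) F d = \sum_(1 <= d < x.+1 | (d %| n)%N) F d)%R.
Proof.
move=> /andP[n0 nx]; rewrite -[RHS]big_filter; apply: perm_big; apply: uniq_perm.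
- exact: divisors_uniq.
- by rewrite filter_uniq // iota_uniq.
move=> d; rewrite mem_filter mem_index_iota -dvdn_divisors //.
case dn : (d %| n) => //=; have := dvdn_gt0 n0 dn; have := dvdn_leq n0 dn; lia.
Qed.

Lemma big_multiples (V : nmodType) (F : nat -> V) x d : 0 < d ->
  (\sum_(1 <= n < x.+1 | (d %| n)%N) F (n %/ d)%N =
   \sum_(1 <= m < (x %/ d).+1) F m)%R.
Proof.
move=> d0; rewrite -big_filter.
rewrite (perm_big [seq m * d | m <- index_iota 1 (x %/ d).+1]); last first.
  apply: uniq_perm; first by rewrite filter_uniq // iota_uniq.
    rewrite map_inj_uniq ?iota_uniq // => a b /eqP; rewrite eqn_pmul2r //.
    by move/eqP.
  move=> n; rewrite mem_filter mem_index_iota; apply/idP/mapP.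
    case/andP=> /dvdnP[m ->] /andP[m0 mx]; exists m => //.
    by rewrite mem_index_iota ltnS leq_divRL //; move: m0 mx; rewrite muln_gt0; lia.
  move=> [m]; rewrite mem_index_iota ltnS leq_divRL // => /andP[m0 mx] ->.
  by rewrite dvdn_mull // ltnS mx andbT /= muln_gt0 m0 d0.
by rewrite big_map; apply: eq_bigr => m _; rewrite mulnK.
Qed.

(** Both sides run over the pairs (d, m) with d m <= x. *)
Lemma sum_divisors_exchange (V : nmodType) (G : nat -> nat -> V) x :
  (\sum_(1 <= n < x.+1) \sum_(d <- divisors n) G d (n %/ d)%N =
   \sum_(1 <= d < x.+1) \sum_(1 <= m < (x %/ d).+1) G d m)%R.
Proof.
rewrite [LHS](@eq_big_nat _ _ _ _ _ _
  (fun n => \sum_(1 <= d < x.+1 | (d %| n)%N) G d (n %/ d)%N)%R); last first.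
  by move=> n nx; apply: big_divisors_le; lia.
under eq_bigr do rewrite big_mkcond.
rewrite exchange_big_nat /=; apply: eq_big_nat => d /andP[d0 _].
by rewrite -big_mkcond /= (big_multiples _ (G d)).
Qed.

Definition omega n := size (primes n).
Definition bigomega n := \sum_(p <- primes n) logn p n.
Definition tau n := size (divisors n).

Lemma primes_pfactorM p k m : prime p -> 0 < k -> 0 < m -> ~~ (p %| m) ->
  perm_eq (primes (p ^ k * m)) (p :: primes m).
Proof.
move=> pp k0 m0 pNm; apply: uniq_perm; first exact: primes_uniq.
  by rewrite /= primes_uniq andbT mem_primes (negbTE pNm) !andbF.
have p0 : 0 < p ^ k by rewrite expn_gt0 prime_gt0.
move=> q; rewrite primesM // primesX // primes_prime //.
by rewrite !inE.
Qed.

Lemma omega_pfactorM p k m : prime p -> 0 < k -> 0 < m -> ~~ (p %| m) ->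
  omega (p ^ k * m) = (omega m).+1.
Proof.
move=> pp k0 m0 pNm; rewrite /omega.
by rewrite (perm_size (primes_pfactorM p k m pp k0 m0 pNm)).
Qed.

Lemma dvdn_omega m n : 0 < n -> m %| n -> omega m <= omega n.
Proof.
move=> n0 mn; apply: uniq_leq_size; first exact: primes_uniq.
move=> q; rewrite !mem_primes => /and3P[-> _ qm]; rewrite n0 /=.
exact: dvdn_trans mn.
Qed.

Lemma bigomegaE n b : 0 < n -> n < b ->
  bigomega n = \sum_(0 <= p < b) logn p n.
Proof.
move=> n0 nb; rewrite /bigomega [RHS](bigID (mem (primes n))) /=.
rewrite [X in _ + X]big1 ?addn0; last first.
  by move=> p; rewrite -logn_gt0 -eqn0Ngt => /eqP.
rewrite -[RHS]big_filter; apply: perm_big; apply: uniq_perm.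
- exact: primes_uniq.
- by rewrite filter_uniq // iota_uniq.
move=> p; rewrite mem_filter mem_index_iota /=.
case pn : (p \in primes n) => //=; move: pn.
by rewrite mem_primes => /and3P[_ _ /(dvdn_leq n0)]; lia.
Qed.

Lemma bigomegaM m n : 0 < m -> 0 < n ->
  bigomega (m * n) = bigomega m + bigomega n.
Proof.
move=> m0 n0; have mn0 : 0 < m * n by rewrite muln_gt0 m0.
rewrite (bigomegaE (m * n) (m * n).+1) // (bigomegaE m (m * n).+1) //; last by nia.
rewrite (bigomegaE n (m * n).+1) //; last by nia.
by rewrite -big_split /=; apply: eq_bigr => p _; rewrite lognM.
Qed.

Lemma bigomega1 : bigomega 1 = 0. Proof. by rewrite /bigomega big_nil. Qed.

Lemma bigomegaX p k : prime p -> bigomega (p ^ k) = k.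
Proof.
move=> pp; case: k => [|k]; first exact: bigomega1.
by rewrite /bigomega primesX // primes_prime // big_seq1 pfactorK.
Qed.

(** Halving the exponents of n puts in b only the primes of odd exponent, once
    each.  This passes from omega to the completely additive bigomega, at the
    cost of a convergent sum over a. *)
Lemma square_decomposition n : 0 < n ->
  exists a b, [/\ 0 < a, 0 < b, n = a ^ 2 * b & bigomega b <= omega n].
Proof.
elim/prime_power_ind => {n} [|p k m pp k0 m0 pNm [a [b [a0 b0 mE bm]]]].
  by exists 1, 1; rewrite bigomega1.
have p0 := prime_gt0 pp.
exists (p ^ (k %/ 2) * a), (p ^ (k %% 2) * b).
rewrite !muln_gt0 !expn_gt0 p0 a0 b0; split => //.
  rewrite {1}(divn_eq k 2) expnD expnM mE; ring.
rewrite bigomegaM ?expn_gt0 ?p0 // bigomegaX // omega_pfactorM //.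
by have := ltn_pmod k (isT : 0 < 2); lia.
Qed.

Lemma tau_pfactorM p k m : prime p -> 0 < m -> ~~ (p %| m) ->
  tau (p ^ k * m) = k.+1 * tau m.
Proof.
move=> pp m0 pNm; rewrite /tau (perm_size (divisors_pfactor p k m pp m0 pNm)).
by rewrite size_allpairs size_iota.
Qed.

(** At a prime power, 2 <= k + 1. *)
Lemma exp2_omega_le_tau n : 0 < n -> 2 ^ omega n <= tau n.
Proof.
elim/prime_power_ind => {n} [//|p k m pp k0 m0 pNm IH].
rewrite omega_pfactorM // tau_pfactorM // expnS leq_mul //.
Qed.

Lemma exp2_omega_le n : 0 < n -> 2 ^ omega n <= n.
Proof.
elim/prime_power_ind => {n} [//|p k m pp k0 m0 pNm IH].
rewrite omega_pfactorM // expnS leq_mul //.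
by apply: leq_trans (prime_gt1 pp) _; rewrite -{1}[p]expn1 leq_pexp2l // prime_gt0.
Qed.

(** A prime dividing both x and y is counted twice on the left, and once in each
    term on the right. *)
Lemma omega_mul_gcd x y : 0 < x -> 0 < y ->
  omega x + omega y <= omega (x * y) + omega (gcdn x y).
Proof.
move=> x0 y0; rewrite /omega -size_cat -size_cat.
have g0 : 0 < gcdn x y by rewrite gcdn_gt0 x0.
have pM q : (q \in primes (x * y)) = (q \in primes x) || (q \in primes y).
  exact: primesM.
have pg q : (q \in primes (gcdn x y)) = (q \in primes x) && (q \in primes y).
  rewrite !mem_primes dvdn_gcd g0 x0 y0.
  by case: (prime q); case: (q %| x); case: (q %| y).
apply: eq_leq; apply: perm_size; apply/allP => q _ /=; rewrite !count_cat.
rewrite !count_uniq_mem ?primes_uniq // pM pg.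
by case: (_ \in _); case: (_ \in _).
Qed.

(** The number of ordered factorizations of n into three factors. *)
Definition tau3 n := \sum_(d <- divisors n) tau d.

(** At p^k the claim is (k+1)(k+2)/2 <= (3/2)^k (k+1), with equality for k <= 1.
    It says that the three-fold Dirichlet convolution of (2/3)^bigomega is at
    most tau. *)
Lemma tau3_le n : 0 < n -> 2 ^ bigomega n * tau3 n <= 3 ^ bigomega n * tau n.
Proof.
elim/prime_power_ind => {n} [|p k m pp k0 m0 pNm IH].
  by rewrite bigomega1 /tau3 big_seq1.
have p0 := prime_gt0 pp.
rewrite bigomegaM ?expn_gt0 ?p0 // bigomegaX // tau_pfactorM //.
have -> : tau3 (p ^ k * m) = (\sum_(0 <= j < k.+1) j.+1) * tau3 m.
  rewrite /tau3 (big_divisors_pfactor _ tau p k m pp m0 pNm) big_distrl /=.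
  apply: eq_big_nat => j _; rewrite big_distrr /= !big_seq.
  apply: eq_bigr => e; rewrite -dvdn_divisors // => em; rewrite tau_pfactorM //.
    exact: dvdn_gt0 em.
  by apply: contra pNm => /dvdn_trans; apply.
have key : 2 ^ k * (\sum_(0 <= j < k.+1) j.+1) <= 3 ^ k * k.+1.
  have sE : 2 * (\sum_(0 <= j < k.+1) j.+1) = k.+1 * k.+2.
    elim: (k) => [|j IHj]; first by rewrite big_nat1.
    rewrite big_nat_recr //= mulnDr IHj; lia.
  have e : 2 ^ k * k.+2 <= 2 * 3 ^ k.
    elim: (k) => [//|j IHj]; rewrite !expnS; have := expn_gt0 2 j; nia.
  rewrite -(leq_pmul2l (isT : 0 < 2)) mulnCA sE; nia.
rewrite !expnD.
have := leq_mul key IH; nia.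
Qed.
Lemma bin_le_exp2 n k : 'C(n, k) <= 2 ^ n.
Proof.
have [kn|nk] := leqP k n; last by rewrite bin_small.
rewrite (expnDn 1 1) (bigD1 (Ordinal (kn : k < n.+1))) //=.
by rewrite !exp1n !muln1 leq_addr.
Qed.

(** * Summatory bounds *)

Local Open Scope ring_scope.

Definition harmonic_sum (R : realType) (x : nat) : R :=
  \sum_(1 <= n < x.+1) n%:R^-1.

Lemma harmonic_sum_le (R : realType) x : (0 < x)%N ->
  harmonic_sum R x <= 1 + ln x%:R.
Proof.
case: x => // x _; elim: x => [|x IH].
  by rewrite /harmonic_sum big_nat1 invr1 ln1 addr0.
rewrite /harmonic_sum big_nat_recr //= -/(harmonic_sum R x.+1).
have p1 : 0 < x.+1%:R :> R by rewrite ltr0n.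
have p2 : 0 < x.+2%:R :> R by rewrite ltr0n.
have E : ln (x.+1%:R / x.+2%:R) <= - x.+2%:R^-1 :> R.
  have -> : x.+1%:R / x.+2%:R = 1 + - x.+2%:R^-1 :> R.
    by rewrite -(natr1 x.+1); field.
  apply: le_ln1Dx; rewrite ltrN2 invf_lt1 // ltr1n //.
rewrite ln_div ?posrE // in E; move: IH E.
move: (harmonic_sum R x.+1) (ln x.+1%:R) (ln x.+2%:R) (x.+2%:R^-1) => h a b c; lra.
Qed.

Lemma harmonic_sum_ge0 (R : realType) x : 0 <= harmonic_sum R x.
Proof. by apply: sumr_ge0 => n _; rewrite invr_ge0 ler0n. Qed.

Lemma sum_inv_sqr_tail (R : realFieldType) m x : (0 < m)%N ->
  \sum_(m.+1 <= n < x.+1) (n%:R ^+ 2)^-1 <= m%:R^-1 :> R.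
Proof.
move=> m0; have [xm|mx] := leqP x m.
  by rewrite big_geq ?invr_ge0 ?ler0n.
apply: (@le_trans _ _ (\sum_(m <= n < x) (n%:R^-1 - n.+1%:R^-1))); last first.
  rewrite (@telescope_sumr_eq _ _ _ (fun n => - n%:R^-1)) => [||n _].
  - by rewrite opprK addrC gerBl invr_ge0 ler0n.
  - exact: ltnW.
  - by rewrite opprK addrC.
rewrite big_add1 /=; apply: ler_sum_nat => n /andP[mn _].
have n0 : 0 < n%:R :> R by rewrite ltr0n; exact: leq_trans mn.
have n1 : n.+1%:R = n%:R + 1 :> R by rewrite -natr1.
rewrite n1 -subr_ge0.
have -> : n%:R^-1 - (n%:R + 1)^-1 - ((n%:R + 1) ^+ 2)^-1 =
          (n%:R * (n%:R + 1) ^+ 2)^-1 :> R by field; lra.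
by rewrite invr_ge0 mulr_ge0 ?sqr_ge0 // ltW.
Qed.

Lemma sum_inv_sqr (R : realFieldType) x :
  \sum_(1 <= n < x.+1) (n%:R ^+ 2)^-1 <= 2 :> R.
Proof.
case: x => [|x]; first by rewrite big_geq.
rewrite big_ltn // expr1n invr1.
have := @sum_inv_sqr_tail R 1 x.+1 isT; rewrite invr1.
by move: (\sum_(_ <= _ < _) _) => t; lra.
Qed.

(** Counting by divisors: each d has at most x / d multiples. *)
Lemma sum_tau (R : realType) x : (0 < x)%N ->
  \sum_(1 <= n < x.+1) (tau n)%:R <= x%:R * (1 + ln x%:R) :> R.
Proof.
move=> x0.
have -> : \sum_(1 <= n < x.+1) (tau n)%:R =
    \sum_(1 <= d < x.+1) (x %/ d)%:R :> R.
  have := sum_divisors_exchange R (fun _ _ => 1) x.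
  under eq_bigr do rewrite big_const_seq count_predT iter_addr_0.
  move=> ->; apply: eq_bigr => d _.
  by rewrite big_const_nat subn1 iter_addr_0.
apply: le_trans (ler_wpM2l (ler0n _ _) (harmonic_sum_le _ _ x0)).
rewrite /harmonic_sum big_distrr /=; apply: ler_sum_nat => d /andP[d0 _].
by rewrite ler_pdivlMr ?ltr0n // -natrM ler_nat leq_divM.
Qed.

Lemma sum_tau_inv (R : realType) x :
  \sum_(1 <= n < x.+1) (tau n)%:R / n%:R <= harmonic_sum R x ^+ 2.
Proof.
have -> : \sum_(1 <= n < x.+1) (tau n)%:R / n%:R =
    \sum_(1 <= n < x.+1) \sum_(d <- divisors n) (d%:R^-1 * (n %/ d)%:R^-1) :> R.
  apply: eq_big_nat => n /andP[n0 _].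
  rewrite (eq_big_seq (fun=> n%:R^-1)) => [|d]; last first.
    rewrite -dvdn_divisors // => dn.
    by rewrite -invfM -natrM mulnC divnK.
  by rewrite big_const_seq count_predT iter_addr_0 mulr_natl.
rewrite (sum_divisors_exchange R (fun d m => d%:R^-1 * m%:R^-1)).
rewrite expr2 {1}/harmonic_sum big_distrl /=; apply: ler_sum_nat => d /andP[d0 dx].
rewrite -big_distrr /= ler_wpM2l ?invr_ge0 ?ler0n //.
rewrite /harmonic_sum [leRHS](@big_cat_nat _ _ _ (x %/ d).+1) //=.
  by rewrite lerDl sumr_ge0 // => m _; rewrite invr_ge0 ler0n.
by rewrite ltnS leq_div.
Qed.

(** Grouping the products u a * w b by the value of a b; the right-hand side also
    has the pairs outside the rectangle. *)
Lemma prod_sum_le_conv (R : realFieldType) (u w : nat -> R) x y :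
    (forall n, 0 <= u n) -> (forall n, 0 <= w n) ->
  (\sum_(1 <= a < x.+1) u a) * (\sum_(1 <= b < y.+1) w b) <=
  \sum_(1 <= n < (x * y).+1) \sum_(d <- divisors n) u d * w (n %/ d)%N.
Proof.
move=> u0 w0; rewrite (sum_divisors_exchange R (fun d m => u d * w m)).
have [y0|y0] := posnP y.
  rewrite y0 [X in _ * X]big_geq // mulr0 sumr_ge0 // => d _.
  by rewrite sumr_ge0 // => m _; rewrite mulr_ge0.
rewrite [leRHS](@big_cat_nat _ _ _ x.+1) //=; last by rewrite ltnS leq_pmulr.
apply: ler_wpDr.
  by apply: sumr_ge0 => d _; rewrite sumr_ge0 // => m _; rewrite mulr_ge0.
rewrite big_distrl /=; apply: ler_sum_nat => d /andP[d0 dx].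
rewrite big_distrr /= [leRHS](@big_cat_nat _ _ _ y.+1) //=; last first.
  by rewrite ltnS leq_divRL // mulnC leq_mul2r; apply/orP; right.
by apply: ler_wpDr => //; rewrite sumr_ge0 // => m _; rewrite mulr_ge0.
Qed.

(** The base 2/3 is chosen so that three factors average to the exponent 2 of
    tau = 1 * 1, that is, 3 * (2/3) = 2 at every prime. *)
Definition wt_bigomega (R : realFieldType) n : R := (2 / 3) ^+ bigomega n.

Lemma wt_bigomega_ge0 (R : realFieldType) n : 0 <= wt_bigomega R n.
Proof. by apply: exprn_ge0; lra. Qed.

Lemma wt_bigomegaM (R : realFieldType) m n : (0 < m)%N -> (0 < n)%N ->
  wt_bigomega R (m * n) = wt_bigomega R m * wt_bigomega R n.
Proof. by move=> m0 n0; rewrite /wt_bigomega bigomegaM // exprD. Qed.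

(** Complete multiplicativity turns the cube of the sum into the sum of
    (2/3)^bigomega(m) tau3(m) / m over m <= x^3, to which [tau3_le] applies. *)
Lemma sum_wt_bigomega_inv (R : realType) x :
  (\sum_(1 <= n < x.+1) wt_bigomega R n / n%:R) ^+ 3 <= harmonic_sum R (x ^ 3) ^+ 2.
Proof.
pose u n : R := wt_bigomega R n / n%:R.
have u0 n : 0 <= u n by rewrite mulr_ge0 ?wt_bigomega_ge0 // invr_ge0 ler0n.
have uM d n : (0 < n)%N -> d \in divisors n -> u d * u (n %/ d)%N = u n.
  move=> n0; rewrite -dvdn_divisors // => /dvdnP[e nE].
  move: n0; rewrite nE muln_gt0 => /andP[e0 d0].
  rewrite mulnK // /u wt_bigomegaM // natrM.
  have d1 : d%:R != 0 :> R by rewrite pnatr_eq0 -lt0n.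
  have e1 : e%:R != 0 :> R by rewrite pnatr_eq0 -lt0n.
  by field; rewrite d1 e1.
set F := \sum_(1 <= n < x.+1) _.
have F2 : F ^+ 2 <= \sum_(1 <= n < (x ^ 2).+1) (tau n)%:R * u n.
  rewrite expr2; apply: le_trans (prod_sum_le_conv R u u x x u0 u0) _.
  rewrite mulnn le_eqVlt; apply/orP; left; apply/eqP.
  apply: eq_big_nat => n /andP[n0 _].
  rewrite (eq_big_seq (fun=> u n)) => [|d dn]; last exact: uM.
  by rewrite big_const_seq count_predT iter_addr_0 mulr_natl.
have F3 : F ^+ 3 <= \sum_(1 <= n < (x ^ 3).+1) (tau3 n)%:R * u n.
  have F0 : 0 <= F by apply: sumr_ge0 => n _; exact: u0.
  rewrite exprSr; apply: le_trans (ler_wpM2r F0 F2) _.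
  apply: le_trans (prod_sum_le_conv R _ u (x ^ 2) x _ u0) _ => [n|].
    by rewrite mulr_ge0.
  rewrite -expnSr le_eqVlt; apply/orP; left; apply/eqP.
  apply: eq_big_nat => n /andP[n0 _].
  rewrite natr_sum big_distrl /=; apply: eq_big_seq => d dn.
  by rewrite -mulrA uM.
apply: le_trans F3 _; apply: le_trans (sum_tau_inv _ _).
apply: ler_sum_nat => n /andP[n0 _].
rewrite /u mulrA ler_wpM2r ?invr_ge0 ?ler0n // /wt_bigomega.
have := tau3_le n n0; rewrite -(ler_nat R) !natrM !natrX.
rewrite expr_div_n mulrA ler_pdivrMr ?exprn_gt0 //; lra.
Qed.

Definition wt_omega (R : realFieldType) n : R := (2 / 3) ^+ omega n.

Lemma wt_omega_ge0 (R : realFieldType) n : 0 <= wt_omega R n.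
Proof. by apply: exprn_ge0; lra. Qed.

(** Writing n = a^2 b as in [square_decomposition] bounds the sum by the product
    of the sums over a of 1 / a^2 and over b. *)
Lemma sum_wt_omega_inv_le (R : realFieldType) x :
  \sum_(1 <= n < x.+1) wt_omega R n / n%:R <=
  2 * \sum_(1 <= n < x.+1) wt_bigomega R n / n%:R.
Proof.
pose G a b : R := (a%:R ^+ 2)^-1 * (wt_bigomega R b / b%:R).
have G0 a b : 0 <= G a b.
  by rewrite mulr_ge0 ?invr_ge0 ?sqr_ge0 // mulr_ge0 ?wt_bigomega_ge0 ?invr_ge0 ?ler0n.
have key n : (0 < n < x.+1)%N -> wt_omega R n / n%:R <=
    \sum_(1 <= a < x.+1) \sum_(1 <= b < x.+1) (if (a ^ 2 * b == n)%N then G a b else 0).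
  move=> /andP[n0 nx].
  have [a [b [a0 b0 nE ab]]] := square_decomposition n n0.
  have ax : (a < x.+1)%N by apply: leq_ltn_trans nx; rewrite nE; nia.
  have bx : (b < x.+1)%N by apply: leq_ltn_trans nx; rewrite nE; nia.
  rewrite (bigD1_seq a) ?iota_uniq ?mem_index_iota ?a0 //=.
  apply: ler_wpDr.
    by rewrite sumr_ge0 // => i _; rewrite sumr_ge0 // => j _; case: ifP.
  rewrite (bigD1_seq b) ?iota_uniq ?mem_index_iota ?b0 //= -nE eqxx.
  apply: ler_wpDr; first by rewrite sumr_ge0 // => j _; case: ifP.
  rewrite /G {2}nE natrM natrX invfM mulrCA ler_wpM2l ?invr_ge0 ?sqr_ge0 //.
  rewrite ler_wpM2r ?invr_ge0 ?ler0n // /wt_omega /wt_bigomega.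
  by apply: ler_wiXn2l => //; lra.
apply: le_trans (ler_sum_nat _) _; first exact: key.
rewrite exchange_big_nat /=.
apply: (@le_trans _ _ (\sum_(1 <= a < x.+1) \sum_(1 <= b < x.+1) G a b)).
  apply: ler_sum => a _; rewrite exchange_big_nat /=; apply: ler_sum => b _.
  have [abx|abx] := boolP (0 < a ^ 2 * b < x.+1)%N; last first.
    rewrite big_nat_cond big1 // => n; rewrite andbT => nx.
    by case: eqP => // E; rewrite E nx in abx.
  rewrite (bigD1_seq (a ^ 2 * b)%N) ?iota_uniq ?mem_index_iota //= eqxx.
  by rewrite big1 ?addr0 // => n; rewrite eq_sym => /negbTE ->.
rewrite /G.
rewrite (eq_bigr (fun a => (a%:R ^+ 2)^-1 *
    \sum_(1 <= b < x.+1) (wt_bigomega R b / b%:R))); last first.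
  by move=> a _; rewrite mulr_sumr.
rewrite -mulr_suml ler_wpM2r ?sum_inv_sqr //.
by rewrite sumr_ge0 // => n _; rewrite mulr_ge0 ?wt_bigomega_ge0 ?invr_ge0 ?ler0n.
Qed.

(** * Chebyshev's bound and integers with few prime factors *)

(** Prime powers are the integers with a single prime divisor, which is then
    [pdiv n]. *)
Definition vonMangoldt (R : realType) (n : nat) : R :=
  if omega n == 1%N then ln (pdiv n)%:R else 0.

Lemma vonMangoldt_ge0 (R : realType) n : 0 <= vonMangoldt R n.
Proof.
by rewrite /vonMangoldt; case: ifP => // _; rewrite ln_ge0 // ler1n pdiv_gt0.
Qed.

Lemma sum_vonMangoldt (R : realType) n : (0 < n)%N ->
  \sum_(d <- divisors n) vonMangoldt R d = ln n%:R.
Proof.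
elim/prime_power_ind => {n} [|p k m pp k0 m0 pNm IH].
  by rewrite big_seq1 /vonMangoldt /= ln1.
have p0 : 0 < p%:R :> R by rewrite ltr0n prime_gt0.
rewrite (big_divisors_pfactor _ _ p k m pp m0 pNm) big_ltn //.
rewrite [X in X + _](eq_bigr (vonMangoldt R)) => [|e _]; last by rewrite mul1n.
have pk0 : 0 < p%:R ^+ k :> R by exact: exprn_gt0.
have m1 : 0 < m%:R :> R by rewrite ltr0n.
rewrite IH natrM natrX lnM ?posrE // lnXn // addrC.
congr (_ + _).
rewrite (eq_big_nat _ _ (F2 := fun=> ln p%:R)) => [|j /andP[j0 _]].
  by rewrite big_const_nat subn1 iter_addr_0.
have mem1 : 1%N \in divisors m by exact: divisor1.
rewrite (bigD1_seq _ mem1 (divisors_uniq m)) /= muln1.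
rewrite big_seq_cond big1 ?addr0 => [|e /andP[em e1]].
  rewrite /vonMangoldt -[(p ^ j)%N]muln1 omega_pfactorM //; last first.
    by rewrite dvdn1; have := prime_gt1 pp; lia.
  by case: j j0 => // j _; rewrite muln1 pdiv_pfactor.
rewrite -dvdn_divisors // in em; have e0 := dvdn_gt0 m0 em.
have pNe : ~~ (p %| e)%N by apply: contra pNm => /dvdn_trans; apply.
rewrite /vonMangoldt omega_pfactorM // eqSS.
by rewrite /omega size_eq0 primes_eq0; case: ifP => // ?; lia.
Qed.

Lemma sum_ln (R : realType) x : \sum_(1 <= n < x.+1) ln n%:R = ln x`!%:R :> R.
Proof.
elim: x => [|x IH]; first by rewrite big_geq // fact0 ln1.
by rewrite big_nat_recr //= IH factS natrM lnM ?posrE ?ltr0n ?fact_gt0 // addrC.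
Qed.

Lemma ln_fact (R : realType) x y : (x <= y)%N ->
  ln x`!%:R = \sum_(1 <= d < y.+1) vonMangoldt R d * (x %/ d)%:R.
Proof.
move=> xy; rewrite -sum_ln.
rewrite (eq_big_nat _ _
  (F2 := fun n => \sum_(d <- divisors n) vonMangoldt R d)) => [|n /andP[n0 _]].
  2: by rewrite sum_vonMangoldt.
rewrite (sum_divisors_exchange R (fun d _ => vonMangoldt R d)).
rewrite [RHS](@big_cat_nat _ _ _ x.+1) //=.
rewrite [X in _ = _ + X]big_nat_cond [X in _ = _ + X]big1 ?addr0 => [|d].
  apply: eq_bigr => d _.
  by rewrite big_const_nat subn1 iter_addr_0 mulr_natr.
by rewrite andbT => /andP[xd _]; rewrite divn_small // mulr0.
Qed.

Definition chebyshevPsi (R : realType) (x : nat) : R :=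
  \sum_(1 <= d < x.+1) vonMangoldt R d.

(** Chebyshev's argument: ln C(2n, n) <= 2 n ln 2, and by [ln_fact] its expansion
    in vonMangoldt has nonnegative coefficients, equal to 1 for n < d <= 2n. *)
Lemma chebyshevPsi_double (R : realType) n :
  chebyshevPsi R n.*2 <= chebyshevPsi R n + n.*2%:R * ln 2.
Proof.
have nn : (n <= n.*2)%N by lia.
have L : ln n.*2`!%:R - 2 * ln n`!%:R <= n.*2%:R * ln 2 :> R.
  have f0 m : 0 < m`!%:R :> R by rewrite ltr0n fact_gt0.
  have := bin_fact nn; rewrite -{2}addnn addnK => <-.
  have c0 : 0 < 'C(n.*2, n)%:R :> R by rewrite ltr0n bin_gt0.
  rewrite !natrM !lnM ?posrE ?mulr_gt0 //.
  have : ln 'C(n.*2, n)%:R <= ln (2 ^+ n.*2) :> R.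
    rewrite ler_ln ?posrE ?exprn_gt0 // -natrX ler_nat; exact: bin_le_exp2.
  by rewrite lnXn // -mulr_natl; lra.
rewrite -lerBlDl; apply: le_trans L.
rewrite (ln_fact R _ _ (leqnn n.*2)) (ln_fact R _ _ nn) mulr_sumr -sumrB.
rewrite /chebyshevPsi [X in X - _](@big_cat_nat _ _ _ n.+1) //= addrAC subrr add0r.
rewrite [leRHS](@big_cat_nat _ _ _ n.+1) //=.
have F d : vonMangoldt R d * (n.*2 %/ d)%:R - 2 * (vonMangoldt R d * (n %/ d)%:R) =
    vonMangoldt R d * (n.*2 %/ d - (n %/ d).*2)%N%:R.
  rewrite natrB; last first.
    by have [->//|d0] := posnP d; rewrite leq_divRL // -doubleMl leq_double leq_divM.
  by rewrite -[(n %/ d).*2]mul2n natrM; ring.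
apply: ler_wpDl.
  by apply: sumr_ge0 => d _; rewrite F mulr_ge0 ?vonMangoldt_ge0.
apply: ler_sum_nat => d /andP[nd dn]; rewrite F.
rewrite -[leLHS]mulr1 ler_wpM2l ?vonMangoldt_ge0 // ler1n subn_gt0.
by rewrite (divn_small nd) leq_divRL ?mul1n //; lia.
Qed.

Lemma chebyshevPsi_mono (R : realType) m n : (m <= n)%N ->
  chebyshevPsi R m <= chebyshevPsi R n.
Proof.
move=> mn; rewrite /chebyshevPsi [leRHS](@big_cat_nat _ _ _ m.+1) //=.
by rewrite lerDl sumr_ge0 // => d _; exact: vonMangoldt_ge0.
Qed.

Lemma ln2_le1 (R : realType) : ln 2 <= 1 :> R.
Proof. by have := @le_ln1Dx R 1; rewrite -[1 + 1]/(2%:R); apply; lra. Qed.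

Lemma chebyshevPsi_le (R : realType) x : chebyshevPsi R x <= 4 * x%:R.
Proof.
(* Doubling gives the powers of 2; any x is within a factor 2 of one. *)
have H t : chebyshevPsi R (2 ^ t) <= 2 * (2 ^ t)%:R.
  elim: t => [|t IH].
    rewrite /chebyshevPsi big_nat1 /vonMangoldt /=; lra.
  rewrite expnS mul2n; apply: le_trans (chebyshevPsi_double _ _) _.
  have := ln2_le1 R; have : 0 <= (2 ^ t)%:R :> R by [].
  rewrite -muln2 natrM; nra.
have [->|x0] := posnP x; first by rewrite /chebyshevPsi big_geq // mulr0.
have := trunc_log_ltn x (isT : (1 < 2)%N) => /ltnW /(chebyshevPsi_mono R) h.
apply: le_trans h _; apply: le_trans (H _) _.
rewrite expnS natrM mulrA; have := trunc_logP (isT : (1 < 2)%N) x0.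
rewrite -(ler_nat R); lra.
Qed.

Lemma wt_omega_anti (R : realFieldType) m n : (0 < n)%N -> (m %| n)%N ->
  wt_omega R n <= wt_omega R m.
Proof. by move=> n0 mn; apply: ler_wiXn2l; rewrite ?dvdn_omega //; lra. Qed.

(** Expand ln n over the divisors n/d, drop the prime power from the weight, which
    can only increase it, and sum over the prime powers first. *)
Lemma sum_wt_omega_ln (R : realType) x :
  \sum_(1 <= n < x.+1) wt_omega R n * ln n%:R <=
  4 * x%:R * \sum_(1 <= n < x.+1) wt_omega R n / n%:R.
Proof.
apply: (@le_trans _ _ (\sum_(1 <= n < x.+1)
    \sum_(d <- divisors n) wt_omega R d * vonMangoldt R (n %/ d))).
  apply: ler_sum_nat => n /andP[n0 _]; rewrite -sum_vonMangoldt // mulr_sumr.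
  rewrite [leLHS](perm_big [seq (n %/ d)%N | d <- divisors n]) /=.
    rewrite big_map big_seq [leRHS]big_seq.
    apply: ler_sum => d; rewrite -dvdn_divisors // => dn.
    by rewrite ler_wpM2r ?vonMangoldt_ge0 // wt_omega_anti.
  have dd d : (d %| n)%N -> (n %/ (n %/ d) = d)%N.
    move=> /dvdnP[e nE]; move: n0; rewrite nE muln_gt0 => /andP[e0 d0].
    by rewrite mulnK // mulKn.
  rewrite perm_sym; apply: uniq_perm => [||d]; [|exact: divisors_uniq|].
    rewrite map_inj_in_uniq ?divisors_uniq // => d e.
    by rewrite -!dvdn_divisors // => dn en E; rewrite -(dd _ dn) E dd.
  rewrite -dvdn_divisors //; apply/mapP/idP => [[e en ->]|dn].
    by rewrite -dvdn_divisors // in en; rewrite dvdn_div.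
  by exists (n %/ d)%N; rewrite -?dvdn_divisors ?dvdn_div ?dd.
rewrite (sum_divisors_exchange R (fun d m => wt_omega R d * vonMangoldt R m)).
rewrite mulr_sumr; apply: ler_sum_nat => d /andP[d0 _].
rewrite -mulr_sumr mulrCA; apply: ler_wpM2l; first exact: wt_omega_ge0.
apply: le_trans (chebyshevPsi_le R _) _; rewrite -mulrA ler_wpM2l //.
by rewrite ler_pdivlMr ?ltr0n // -natrM ler_nat leq_divM.
Qed.

(** Split ln x = ln n + ln (x / n) and use ln (x / n) < x / n for the second
    term. *)
Lemma sum_wt_omega_le (R : realType) x : (0 < x)%N ->
  ln x%:R * \sum_(1 <= n < x.+1) wt_omega R n <=
  5 * x%:R * \sum_(1 <= n < x.+1) wt_omega R n / n%:R.
Proof.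
move=> x0; have xr : 0 < x%:R :> R by rewrite ltr0n.
have -> : ln x%:R * \sum_(1 <= n < x.+1) wt_omega R n =
    \sum_(1 <= n < x.+1) wt_omega R n * ln n%:R +
    \sum_(1 <= n < x.+1) wt_omega R n * ln (x%:R / n%:R).
  rewrite mulr_sumr -big_split /=; apply: eq_big_nat => n /andP[n0 _].
  by rewrite ln_div ?posrE ?ltr0n //; ring.
have -> : 5 * x%:R * \sum_(1 <= n < x.+1) wt_omega R n / n%:R =
    4 * x%:R * (\sum_(1 <= n < x.+1) wt_omega R n / n%:R) +
    \sum_(1 <= n < x.+1) wt_omega R n * (x%:R / n%:R) :> R.
  have -> : \sum_(1 <= n < x.+1) wt_omega R n * (x%:R / n%:R) =
      x%:R * \sum_(1 <= n < x.+1) wt_omega R n / n%:R :> R.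
    by rewrite mulr_sumr; apply: eq_bigr => n _; rewrite mulrCA.
  ring.
apply: lerD; first exact: sum_wt_omega_ln.
apply: ler_sum_nat => n /andP[n0 _]; rewrite ler_wpM2l ?wt_omega_ge0 //.
by apply/ltW/ln_sublinear; rewrite divr_gt0 ?ltr0n.
Qed.

Lemma sum_wt_omega_cube (R : realType) x : (0 < x)%N -> 1 <= ln x%:R :> R ->
  (\sum_(1 <= n < x.+1) wt_omega R n) ^+ 3 * ln x%:R <= 16 ^+ 4 * x%:R ^+ 3 :> R.
Proof.
move=> x0 L1; set B := \sum_(_ <= _ < _) _.
set L := ln x%:R in L1 *.
have B0 : 0 <= B by apply: sumr_ge0 => n _; exact: wt_omega_ge0.
pose S : R := \sum_(1 <= n < x.+1) wt_omega R n / n%:R.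
pose F : R := \sum_(1 <= n < x.+1) wt_bigomega R n / n%:R.
have S0 : 0 <= S.
  by apply: sumr_ge0 => n _; rewrite mulr_ge0 ?wt_omega_ge0 ?invr_ge0 ?ler0n.
have F0 : 0 <= F.
  by apply: sumr_ge0 => n _; rewrite mulr_ge0 ?wt_bigomega_ge0 ?invr_ge0 ?ler0n.
have LB : L * B <= 5 * x%:R * S by exact: sum_wt_omega_le.
have SF : S <= 2 * F by exact: sum_wt_omega_inv_le.
have FH : F ^+ 3 <= (4 * L) ^+ 2.
  apply: le_trans (sum_wt_bigomega_inv R x) _.
  rewrite lerXn2r ?nnegrE ?harmonic_sum_ge0 //; first by lra.
  apply: le_trans (harmonic_sum_le R _ _) _; first by rewrite expn_gt0 x0.
  by rewrite natrX lnXn ?ltr0n // -/L -mulr_natl; lra.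
have : (L * B) ^+ 3 <= (16 * x%:R * F) ^+ 3.
  rewrite lerXn2r ?nnegrE ?mulr_ge0 //; first by lra.
  by apply: le_trans LB _; have : 0 <= x%:R :> R by []; nra.
rewrite !exprMn => H.
have : L ^+ 2 * (B ^+ 3 * L) <= L ^+ 2 * (16 ^+ 4 * x%:R ^+ 3).
  apply: le_trans (_ : 16 ^+ 3 * x%:R ^+ 3 * (4 * L) ^+ 2 <= _).
    apply: le_trans (_ : 16 ^+ 3 * x%:R ^+ 3 * F ^+ 3 <= _).
      by apply: le_trans H; rewrite le_eqVlt; apply/orP; left; apply/eqP; ring.
    by rewrite ler_wpM2l // mulr_ge0 ?exprn_ge0.
  by rewrite le_eqVlt; apply/orP; left; apply/eqP; ring.
by rewrite ler_pM2l // exprn_gt0 //; lra.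
Qed.

(** * Sets of pairs with distinct products *)

Lemma ler_sum_subset (R : numDomainType) (I : eqType) (r s : seq I) (F : I -> R) :
    uniq r -> uniq s -> {subset r <= s} -> (forall i, 0 <= F i) ->
  \sum_(i <- r) F i <= \sum_(i <- s) F i.
Proof.
move=> ur us rs F0; rewrite [leRHS](bigID (mem r)) /= -[X in X + _]big_filter.
have E : perm_eq [seq i <- s | i \in r] r.
  apply: uniq_perm => // [|i]; first exact: filter_uniq.
  by rewrite mem_filter; case ir : (i \in r) => //=; rewrite rs.
by rewrite (perm_big _ E) lerDl sumr_ge0.
Qed.

Definition box N (v : nat * nat) := (0 < v.1 <= N)%N && (0 < v.2 <= N)%N.

Lemma ler_sum_box (R : numDomainType) N (S : seq (nat * nat)) (h : nat -> nat -> R) :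
    uniq S -> all (box N) S -> (forall x y, 0 <= h x y) ->
  \sum_(v <- S) h v.1 v.2 <= \sum_(1 <= x < N.+1) \sum_(1 <= y < N.+1) h x y.
Proof.
move=> uS /allP SN h0.
apply: (@le_trans _ _ (\sum_(v <- [seq (x, y) | x <- index_iota 1 N.+1,
    y <- index_iota 1 N.+1]) h v.1 v.2)); last by rewrite big_allpairs_dep.
apply: ler_sum_subset => //.
  by apply: allpairs_uniq => [||[a b] [c d] _ _ []]; rewrite ?iota_uniq // => -> ->.
move=> [x y] /SN /andP[/= x0 y0]; apply/allpairsPdep; exists x, y.
by rewrite !mem_index_iota !ltnS.
Qed.

(** A common divisor g > G is shared by at most (N / g)^2 pairs. *)
Lemma count_gcd_gt (R : realFieldType) N G : (0 < G)%N ->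
  \sum_(1 <= x < N.+1) \sum_(1 <= y < N.+1) (G < gcdn x y)%:R <=
  N%:R ^+ 2 / G%:R :> R.
Proof.
move=> G0; pose dv g x : R := (g %| x)%:R.
have dv0 g x : 0 <= dv g x by [].
have le1 x y : (0 < x < N.+1)%N -> (0 < y < N.+1)%N ->
    (G < gcdn x y)%:R <= \sum_(G.+1 <= g < N.+1) dv g x * dv g y.
  move=> /andP[x0 xN] /andP[y0 yN]; case: ltnP => Gg; last first.
    by rewrite sumr_ge0 // => g _; rewrite mulr_ge0.
  rewrite (bigD1_seq (gcdn x y)) ?iota_uniq //=; last first.
    by rewrite mem_index_iota Gg ltnS (leq_trans (dvdn_leq x0 (dvdn_gcdl x y))).
  rewrite /dv dvdn_gcdl dvdn_gcdr mulr1 lerDl; apply: sumr_ge0 => g _.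
  exact: mulr_ge0.
apply: (@le_trans _ _ (\sum_(1 <= x < N.+1) \sum_(1 <= y < N.+1)
    \sum_(G.+1 <= g < N.+1) dv g x * dv g y)).
  by apply: ler_sum_nat => x xN; apply: ler_sum_nat => y yN; exact: le1.
under eq_bigr do rewrite exchange_big_nat /=.
rewrite exchange_big_nat /=.
apply: (@le_trans _ _ (\sum_(G.+1 <= g < N.+1) N%:R ^+ 2 * (g%:R ^+ 2)^-1)).
  apply: ler_sum_nat => g /andP[Gg _].
  have g0 : (0 < g)%N by exact: leq_ltn_trans Gg.
  have cnt : \sum_(1 <= x < N.+1) dv g x = (N %/ g)%:R.
    have := big_multiples R (fun=> 1) N g g0.
    rewrite [RHS]big_const_nat subn1 iter_addr_0 => <-.
    by rewrite [RHS]big_mkcond; apply: eq_bigr => x _; rewrite /dv; case: ifP.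
  under eq_bigr do rewrite -mulr_sumr cnt.
  rewrite -mulr_suml cnt -expr2 -exprVn -exprMn lerXn2r ?nnegrE //.
  by rewrite ler_pdivlMr ?ltr0n // -natrM ler_nat leq_divM.
rewrite -mulr_sumr ler_wpM2l ?sqr_ge0 //; exact: sum_inv_sqr_tail.
Qed.

(** The three terms are each at least 1 in one of the cases: large gcd, few prime
    factors in x and y together, many prime factors in the product. *)
Lemma one_le_cover (R : realFieldType) G K x y : (0 < x)%N -> (0 < y)%N ->
  1 <= (G < gcdn x y)%:R + (3 / 2) ^+ K * (wt_omega R x * wt_omega R y) +
       G%:R / 2 ^+ K * (2 ^ omega (x * y))%:R :> R.
Proof.
move=> x0 y0; have w0 : 0 <= (3 / 2) ^+ K * (wt_omega R x * wt_omega R y).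
  by rewrite !mulr_ge0 ?wt_omega_ge0 // exprn_ge0 //; lra.
have t0 : 0 <= G%:R / 2 ^+ K * (2 ^ omega (x * y))%:R :> R.
  by rewrite !mulr_ge0 ?invr_ge0 ?exprn_ge0.
case: ltnP => gG; first by rewrite -[X in X <= _]addr0 -addrA lerD // addr_ge0.
rewrite add0r; have [Kw|wK] := leqP K (omega x + omega y).
  apply: ler_wpDl => //; rewrite mulrAC ler_pdivlMr ?exprn_gt0 // mul1r.
  rewrite -natrX -natrM ler_nat.
  apply: (@leq_trans (2 ^ (omega x + omega y))); first by rewrite leq_pexp2l.
  apply: (@leq_trans (2 ^ (omega (x * y) + omega (gcdn x y)))).
    by rewrite leq_pexp2l // omega_mul_gcd.
  rewrite expnD mulnC leq_mul //; apply: leq_trans gG.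
  by apply: exp2_omega_le; rewrite gcdn_gt0 x0.
apply: ler_wpDr => //; rewrite /wt_omega -exprD.
rewrite -(subnK (ltnW wK)) exprD -mulrA -exprMn.
have -> : 3 / 2 * (2 / 3) = 1 :> R by field.
by rewrite expr1n mulr1 exprn_ege1 //; lra.
Qed.

(** Summing [one_le_cover] over S; as the products are distinct, the last term
    becomes a sum over distinct integers n <= N^2, bounded by [sum_tau]. *)
Lemma injective_product_count (R : realType) N (S : seq (nat * nat)) G K :
    (0 < N)%N -> (0 < G)%N -> uniq S -> all (box N) S ->
    {in S &, injective (fun v => v.1 * v.2)%N} ->
  (size S)%:R <= N%:R ^+ 2 / G%:R
    + (3 / 2) ^+ K * (\sum_(1 <= n < N.+1) wt_omega R n) ^+ 2
    + G%:R / 2 ^+ K * (N%:R ^+ 2 * (1 + 2 * ln N%:R)) :> R.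
Proof.
move=> N0 G0 uS SN injS.
have -> : (size S)%:R = \sum_(v <- S) 1 :> R.
  by rewrite big_const_seq count_predT iter_addr_0.
apply: (@le_trans _ _ (\sum_(v <- S) ((G < gcdn v.1 v.2)%:R
    + (3 / 2) ^+ K * (wt_omega R v.1 * wt_omega R v.2)
    + G%:R / 2 ^+ K * (2 ^ omega (v.1 * v.2))%:R))).
  rewrite big_seq [leRHS]big_seq; apply: ler_sum => v /(allP SN).
  by move=> /andP[/andP[x0 _] /andP[y0 _]]; exact: one_le_cover.
rewrite !big_split /=; apply: lerD; first apply: lerD.
- apply: le_trans (count_gcd_gt R N G G0).
  exact: (ler_sum_box R N S (fun x y => (G < gcdn x y)%:R)).
- rewrite -mulr_sumr ler_wpM2l ?exprn_ge0 //.
  apply: le_trans (ler_sum_box R N S (fun x y => wt_omega R x * wt_omega R y) uS SN _) _.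
    by move=> x y; rewrite mulr_ge0 ?wt_omega_ge0.
  rewrite expr2 mulr_suml; apply: ler_sum => x _.
  by rewrite mulr_sumr.
- rewrite -mulr_sumr ler_wpM2l ?mulr_ge0 ?invr_ge0 ?exprn_ge0 //.
  rewrite -(big_map (fun v => v.1 * v.2)%N predT (fun n => (2 ^ omega n)%:R)).
  apply: (@le_trans _ _ (\sum_(1 <= n < (N ^ 2).+1) (2 ^ omega n)%:R)).
    apply: ler_sum_subset => //; rewrite ?map_inj_in_uniq ?iota_uniq //.
    move=> n /mapP[v /(allP SN) /andP[/andP[x0 xN] /andP[y0 yN]] ->].
    by rewrite mem_index_iota muln_gt0 x0 y0 ltnS -mulnn leq_mul.
  apply: (@le_trans _ _ (\sum_(1 <= n < (N ^ 2).+1) (tau n)%:R)).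
    by apply: ler_sum_nat => n /andP[n0 _]; rewrite ler_nat exp2_omega_le_tau.
  apply: le_trans (sum_tau R _ _) _; first by rewrite expn_gt0 N0.
  by rewrite natrX lnXn ?ltr0n // mulr_natl.
Qed.

(** Fifteenth powers clear the exponents: (3/2)^15 <= 2^9, and B^30 is the tenth
    power of B^3.  With P = 2^t and Q = 2^s the left-hand side becomes at most
    (P Q^2)^9 (c N^3 / P)^10 = c^10 N^30 Q^18 / P, and P >= Q^33. *)
Lemma low_omega_term_le (R : realFieldType) (c B N L : R) s t :
    1 <= c -> 0 <= B -> 0 <= N ->
    2 ^+ t <= L -> (33 * s <= t)%N -> B ^+ 3 * L <= c * N ^+ 3 ->
  (3 / 2) ^+ (t + 2 * s) * B ^+ 2 <= c * N ^+ 2 / 2 ^+ s.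
Proof.
move=> c1 B0 N0 tL st BL.
have c0 : 0 <= c by lra.
have p2 n : 0 < 2 ^+ n :> R by exact: exprn_gt0.
have K0 : 0 <= (3 / 2) ^+ (t + 2 * s) :> R by rewrite exprn_ge0 //; lra.
(* Here 2^9 = 512 is just above (3/2)^15. *)
have q1 : ((3 / 2) ^+ (t + 2 * s)) ^+ 15 <= (2 ^+ t * (2 ^+ s) ^+ 2) ^+ 9 :> R.
  have -> : 2 ^+ t * (2 ^+ s) ^+ 2 = 2 ^+ (t + 2 * s) :> R.
    by rewrite exprD mulnC exprM.
  rewrite [leLHS]exprAC [leRHS]exprAC.
  apply: lerXn2r; rewrite ?nnegrE; try by apply: exprn_ge0; lra.
  by rewrite !exprS !expr0; lra.
have BLt : B ^+ 3 <= c * N ^+ 3 / 2 ^+ t.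
  rewrite ler_pdivlMr //; apply: le_trans BL.
  by apply: ler_wpM2l => //; exact: exprn_ge0.
have q2 : (B ^+ 2) ^+ 15 <= (c * N ^+ 3 / 2 ^+ t) ^+ 10.
  have -> : (B ^+ 2) ^+ 15 = (B ^+ 3) ^+ 10 by rewrite -!exprM.
  have B3 : 0 <= B ^+ 3 by exact: exprn_ge0.
  by apply: lerXn2r; rewrite ?nnegrE //; exact: le_trans BLt.
have q3 : (2 ^+ s) ^+ 33 <= 2 ^+ t :> R.
  by rewrite -exprM; apply: ler_weXn2l; [lra|rewrite mulnC].
have l0 : 0 <= (3 / 2) ^+ (t + 2 * s) * B ^+ 2 by rewrite mulr_ge0 // exprn_ge0.
have r0 : 0 <= c * N ^+ 2 / 2 ^+ s.
  by apply: divr_ge0; [apply: mulr_ge0 => //; exact: exprn_ge0|exact: ltW].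
rewrite -(@ler_pXn2r _ 15) ?nnegrE //.
rewrite exprMn; apply: le_trans (ler_pM _ _ q1 q2) _;
  [exact: exprn_ge0|by apply/exprn_ge0/exprn_ge0|].
move: (2 ^+ t) (2 ^+ s) (p2 t) (p2 s) q3 => P Q P0 Q0 QP.
have -> : (P * Q ^+ 2) ^+ 9 * (c * N ^+ 3 / P) ^+ 10 =
    c ^+ 10 * (N ^+ 30 * Q ^+ 18) / P.
  have PP : P ^+ 9 / P ^+ 10 = P^-1.
    by rewrite [P ^+ 10]exprSr invfM mulrA divff ?mul1r // lt0r_neq0 // exprn_gt0.
  rewrite (exprMn 9 P) (exprMn 10 (c * _)) (exprMn 10 c) -!exprM exprVn -PP.
  move: (P ^+ 9) (P ^+ 10)^-1 (Q ^+ _) (N ^+ _) (c ^+ _) => a b d e f; ring.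
have -> : (c * N ^+ 2 / Q) ^+ 15 = c ^+ 15 * (N ^+ 30 * Q ^+ 18) / Q ^+ 33.
  have QQ : Q ^+ 18 / Q ^+ 33 = (Q ^+ 15)^-1.
    rewrite (exprD Q 18 15) invfM mulrA divff ?mul1r // lt0r_neq0 //.
    exact: exprn_gt0.
  by rewrite (exprMn 15 (c * _)) (exprMn 15 c) -!exprM exprVn -QQ !mulrA.
have NQ : 0 <= N ^+ 30 * Q ^+ 18.
  by apply: mulr_ge0; [exact: exprn_ge0|exact/exprn_ge0/ltW].
have Q33 : 0 < Q ^+ 33 by exact: exprn_gt0.
have PV : P^-1 <= Q ^- 33 by rewrite lef_pV2 ?posrE.
apply: ler_pM => //.
- by apply: mulr_ge0 => //; exact: exprn_ge0.
- by rewrite invr_ge0 ltW.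
- by apply: ler_wpM2r => //; exact: ler_weXn2l.
Qed.

(** The threshold K = t + 2 s lies slightly above log2 (ln N), and the gcd is cut
    at 2^s, so that each of the three terms of [injective_product_count] saves a
    factor 2^s. *)
Lemma injective_product_le (R : realType) N (S : seq (nat * nat)) s t :
    (0 < N)%N -> uniq S -> all (box N) S ->
    {in S &, injective (fun v => v.1 * v.2)%N} ->
    2 ^+ t <= (ln N%:R : R) < 2 ^+ t.+1 -> (33 * s <= t)%N ->
  (size S)%:R <= 2 ^+ 17 * N%:R ^+ 2 / 2 ^+ s :> R.
Proof.
move=> N0 uS SN injS /andP[tL Lt] st.
apply: le_trans (injective_product_count R N S (2 ^ s) (t + 2 * s) N0 _ uS SN injS) _.
  by rewrite expn_gt0.
set L := ln N%:R in tL Lt *.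
set B := \sum_(_ <= _ < _) _.
have L1 : 1 <= L by apply: le_trans tL; rewrite exprn_ege1 //; lra.
have B0 : 0 <= B by apply: sumr_ge0 => n _; exact: wt_omega_ge0.
have BL : B ^+ 3 * L <= 16 ^+ 4 * N%:R ^+ 3 by exact: sum_wt_omega_cube.
have p2 n : 0 < 2 ^+ n :> R by rewrite exprn_gt0.
have NN : 0 <= N%:R :> R by [].
have A : (3 / 2) ^+ (t + 2 * s) * B ^+ 2 <= 16 ^+ 4 * N%:R ^+ 2 / 2 ^+ s.
  apply: (low_omega_term_le R (16 ^+ 4) B N%:R L s t _ B0 NN tL st BL).
  by rewrite exprn_ege1 //; lra.
rewrite natrX.
have E1 : 2 ^+ s / 2 ^+ (t + 2 * s) = (2 ^+ t)^-1 / 2 ^+ s :> R.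
  by rewrite exprD mulnC exprM expr2; field; rewrite !lt0r_neq0.
have E2 : (2 ^+ t)^-1 * (1 + 2 * L) <= 6.
  rewrite mulrC ler_pdivrMr //; move: Lt; rewrite exprS.
  have : 1 <= 2 ^+ t :> R by rewrite exprn_ege1 //; lra.
  lra.
have E3 : 2 ^+ s / 2 ^+ (t + 2 * s) * (N%:R ^+ 2 * (1 + 2 * L)) <=
    6 * (N%:R ^+ 2 / 2 ^+ s).
  rewrite E1 [leLHS](_ : _ = (2 ^+ t)^-1 * (1 + 2 * L) * (N%:R ^+ 2 / 2 ^+ s)).
    by rewrite ler_wpM2r // mulr_ge0 ?invr_ge0 ?exprn_ge0.
  ring.
rewrite -mulrA in A.
apply: le_trans (lerD (lerD (lexx _) A) E3) _; rewrite -[leRHS]mulrA.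
have c16 : 2 ^+ 17 = 2 * 16 ^+ 4 :> R.
  by rewrite exprS (exprM 2 4 4) -natrX.
have c7 : 7 <= 16 ^+ 4 :> R.
  by apply: (@le_trans _ _ 16); [lra|apply: ler_eXnr => //; lra].
have D0 : 0 <= N%:R ^+ 2 / 2 ^+ s :> R by rewrite divr_ge0 ?exprn_ge0.
rewrite c16; move: c7 D0; move: (16 ^+ 4) (N%:R ^+ 2 / 2 ^+ s) => c x.
by nra.
Qed.

(** * Entropy *)

Section EntropyOfFiniteSupport.
Local Open Scope classical_set_scope.

Lemma le_term_esum (R : realType) (I : choiceType) (a : I -> \bar R) i :
  (forall j, 0 <= a j)%E -> (a i <= \esum_(j in [set: I]) a j)%E.
Proof.
move=> a0; apply: esum_ge; exists [set i]; last by rewrite fsbig_set1.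
by split; [exact: finite_set1|].
Qed.

Lemma esum_eq0_term (R : realType) (I : choiceType) (a : I -> \bar R) i :
  (forall j, 0 <= a j)%E -> (\esum_(j in [set: I]) a j = 0)%E -> a i = 0%E.
Proof.
move=> a0 s0; apply/eqP; rewrite eq_le a0 andbT -s0; exact: le_term_esum.
Qed.

Lemma ln2_gt0 (R : realType) : 0 < ln 2 :> R.
Proof. by apply: ln_gt0; lra. Qed.

Lemma entropy_term_ge0 (R : realType) (p : R) : 0 <= p <= 1 ->
  0 <= - (p * log2 p).
Proof.
move=> /andP[p0 p1]; rewrite -mulrN mulr_ge0 // /log2 -mulNr divr_ge0 //.
  by rewrite oppr_ge0 ln_le0.
by rewrite ltW // ln2_gt0.
Qed.

Lemma entropy_term_eq0 (R : realType) (p : R) : 0 < p ->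
  - (p * log2 p) = 0 -> p = 1.
Proof.
move=> p0 /eqP; rewrite oppr_eq0 mulf_eq0 gt_eqF //= /log2 mulf_eq0 invr_eq0.
by rewrite [ln 2 == 0]gt_eqF ?ln2_gt0 // orbF ln_eq0 // => /eqP.
Qed.

Lemma fine_probability_le (R : realType) (d : measure_display)
    (T : measurableType d) (P : probability T R) (A B : set T) : measurable A -> measurable B ->
  A `<=` B -> fine (P A) <= fine (P B).
Proof.
by move=> mA mB AB; rewrite fine_le ?fin_num_measure // le_measure ?inE.
Qed.

Lemma fine_probability_ge0 (R : realType) (d : measure_display)
    (T : measurableType d) (P : probability T R) (A : set T) : 0 <= fine (P A).
Proof. by rewrite fine_ge0. Qed.

Lemma fine_probability_le1 (R : realType) (d : measure_display)
    (T : measurableType d) (P : probability T R) (A : set T) : measurable A -> fine (P A) <= 1.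
Proof.
move=> mA; rewrite -[1]/(fine 1%E) -(probability_setT P).
by apply: fine_probability_le.
Qed.

Lemma cond_mass_itv (R : realType) (d : measure_display)
    (T : measurableType d) (P : probability T R) (V W : choiceType) (Z : T -> V) (U : T -> W) u v :
    (forall v, measurable (Z @^-1` [set v])) ->
    (forall u, measurable (U @^-1` [set u])) ->
  0 <= cond_mass P Z U u v <= 1.
Proof.
move=> mZ mU; rewrite /cond_mass.
have m0 : 0 <= mass P U u by exact: fine_probability_ge0.
rewrite divr_ge0 ?fine_probability_ge0 //=.
have [->|m1] := eqVneq (mass P U u) 0; first by rewrite invr0 mulr0.
rewrite ler_pdivrMr ?mul1r ?lt_def ?m1 //.
apply: fine_probability_le; [exact: measurableI|exact: mU|exact: subIsetr].
Qed.

Lemma mass_entropy_ge0 (R : realType) (V : choiceType) (p : V -> R) :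
  (forall v, 0 <= p v <= 1) -> (0 <= mass_entropy p)%E.
Proof. by move=> p01; apply: esum_ge0 => v _; rewrite lee_fin entropy_term_ge0. Qed.

(** Zero conditional entropy forces every conditional mass to be 0 or 1, so a
    value v of positive mass carries the whole mass of its image f v; two such
    values with the same image would give that image twice its mass. *)
Lemma cond_entropy0_injective (R : realType) (d : measure_display)
    (T : measurableType d) (P : probability T R) (V W : choiceType) (Z : T -> V) (f : V -> W) :
    (forall v, measurable (Z @^-1` [set v])) ->
    (forall u, measurable ((f \o Z) @^-1` [set u])) ->
    cond_entropy P Z (f \o Z) = 0%E ->
  forall v w, mass P Z v != 0 -> mass P Z w != 0 -> f v = f w -> v = w.
Proof.
move=> mZ mU H0.
have E v : mass P Z v != 0 -> mass P Z v = mass P (f \o Z) (f v).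
  move=> v0; have m0 : 0 < mass P Z v by rewrite lt_def v0 fine_probability_ge0.
  have sub : Z @^-1` [set v] `<=` (f \o Z) @^-1` [set f v] by move=> t /= ->.
  have u0 : 0 < mass P (f \o Z) (f v).
    exact: lt_le_trans m0 (fine_probability_le _ _ _ P _ _ (mZ v) (mU _) sub).
  have c01 w := cond_mass_itv _ _ _ P _ _ Z (f \o Z) (f v) w mZ mU.
  have /(esum_eq0_term _ _ _ (f v)) := H0.
  have nn u : (0 <= (mass P (f \o Z) u)%:E * mass_entropy (cond_mass P Z (f \o Z) u))%E.
    apply: mule_ge0; first by rewrite lee_fin fine_probability_ge0.
    by apply: mass_entropy_ge0 => w; exact: cond_mass_itv.
  move=> /(_ nn) /eqP; rewrite mule_eq0 eqe gt_eqF //= => /eqP.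
  move=> /(esum_eq0_term _ _ _ v) h.
  have /h [] : forall w, (0 <= (- (cond_mass P Z (f \o Z) (f v) w *
      log2 (cond_mass P Z (f \o Z) (f v) w)))%:E)%E.
    by move=> w; rewrite lee_fin entropy_term_ge0.
  have cE : cond_mass P Z (f \o Z) (f v) v = mass P Z v / mass P (f \o Z) (f v).
    by rewrite /cond_mass (setIidl sub).
  rewrite cE => /entropy_term_eq0; rewrite divr_gt0 // => /(_ isT).
  by move/divr1_eq.
move=> v w v0 w0 fvw; apply/eqP/negPn/negP => /eqP vw.
have sub : Z @^-1` [set v] `|` Z @^-1` [set w] `<=` (f \o Z) @^-1` [set f v].
  by move=> t [] /= ->.
have := fine_probability_le _ _ _ P _ _ (measurableU _ _ (mZ v) (mZ w)) (mU _) sub.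
rewrite measureU //; last first.
  by rewrite -subset0 => t [] /= -> /vw.
rewrite fineD ?fin_num_measure // -/(mass P Z v) -/(mass P Z w).
rewrite -/(mass P (f \o Z) (f v)) -E //.
have : 0 < mass P Z w by rewrite lt_def w0 fine_probability_ge0.
lra.
Qed.

Lemma sum_mass (R : realType) (d : measure_display)
    (T : measurableType d) (P : probability T R) (V : choiceType) (Z : T -> V) (S : seq V) :
    (forall v, measurable (Z @^-1` [set v])) -> uniq S -> (forall t, Z t \in S) ->
  \sum_(v <- S) mass P Z v = 1.
Proof.
move=> mZ uS ZS; apply: EFin_inj; rewrite -sumEFin.
rewrite -(probability_setT P).
have -> : [set: T] = \bigcup_(v in [set` S]) (Z @^-1` [set v]).
  by apply/seteqP; split => // t _; exists (Z t) => //=.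
rewrite measure_fin_bigcup //; last exact: trivIset_preimage1.
rewrite -fsbig_seq //; apply: eq_bigr => v _.
by rewrite /mass fineK ?fin_num_measure.
Qed.

(** Gibbs' inequality: ln q <= q - 1 for q = 1 / (|S| p), multiplied by p and
    summed over S. *)
Lemma entropy_le_log2_size (R : realType) (d : measure_display)
    (T : measurableType d) (P : probability T R) (V : choiceType) (Z : T -> V) (S : seq V) :
    (forall v, measurable (Z @^-1` [set v])) -> uniq S ->
    (forall v, mass P Z v != 0 -> v \in S) -> \sum_(v <- S) mass P Z v = 1 ->
  (entropy P Z <= (log2 (size S)%:R)%:E)%E.
Proof.
move=> mZ uS supp tot.
have m01 v : 0 <= mass P Z v <= 1.
  by rewrite fine_probability_ge0 fine_probability_le1.
have S0 : 0 < (size S)%:R :> R.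
  rewrite ltr0n; case: S tot {uS supp} => //; rewrite big_nil => /eqP.
  by rewrite eq_sym oner_eq0.
rewrite /entropy /mass_entropy (esumID [set` S]); last first.
  by move=> v _; rewrite lee_fin entropy_term_ge0.
rewrite [X in (_ + X)%E]esum1 ?adde0; last first.
  move=> v [_ /= /negP vS]; have := contraNeq (supp v) vS.
  by move=> ->; rewrite mul0r oppr0.
rewrite setTI esum_fset //; last first.
  by move=> v _; rewrite lee_fin entropy_term_ge0.
rewrite -fsbig_seq // sumEFin lee_fin.
have term v : - (mass P Z v * log2 (mass P Z v)) <=
    mass P Z v * log2 (size S)%:R + ((size S)%:R^-1 - mass P Z v) / ln 2.
  have /andP[p0 _] := m01 v; move: (mass P Z v) p0 => p p0.
  have l2 := ln2_gt0 R.
  have [->|pn0] := eqVneq p 0.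
    by rewrite !mul0r oppr0 add0r addr0 divr_ge0 ?invr_ge0 ?ltW.
  have pp : 0 < p by rewrite lt_def pn0.
  have -> : - (p * log2 p) = p * log2 (size S)%:R + p * (- ln ((size S)%:R * p)) / ln 2.
    by rewrite lnM ?posrE // /log2; field; rewrite lt0r_neq0.
  rewrite lerD2l ler_wpM2r ?invr_ge0 ?(ltW l2) // -lnV ?posrE ?mulr_gt0 //.
  set q := (_ * p)^-1; have q0 : 0 < q by rewrite invr_gt0 mulr_gt0.
  have -> : (size S)%:R^-1 - p = p * (q - 1).
    by rewrite /q; field; rewrite pn0 lt0r_neq0.
  rewrite ler_wpM2l //; have := @le_ln1Dx R (q - 1).
  by rewrite [1 + _]addrC subrK; apply; lra.
apply: le_trans (ler_sum _ (fun v _ => term v)) _.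
rewrite big_split /= -mulr_suml tot mul1r -mulr_suml sumrB tot.
rewrite big_const_seq count_predT iter_addr_0 -(mulr_natl _^-1) divff ?lt0r_neq0 //.
by rewrite subrr mul0r addr0.
Qed.

End EntropyOfFiniteSupport.

(** * The entropy deficit *)

Lemma dyadic_bracket (R : realType) (L : R) : 1 <= L ->
  exists t, 2 ^+ t <= L < 2 ^+ t.+1.
Proof.
move=> L1; have L0 : 0 <= L by lra.
exists (trunc_log 2 (Num.truncn L)).
have n0 : (0 < Num.truncn L)%N by rewrite truncn_gt0.
rewrite -!natrX -truncn_ge_nat // -truncn_lt_nat //.
by rewrite trunc_logP // trunc_log_ltn.
Qed.

Lemma ler_log2 (R : realType) (x y : R) : 0 < x -> x <= y -> log2 x <= log2 y.
Proof.
move=> x0 xy; rewrite /log2 ler_wpM2r ?invr_ge0 ?(ltW (ln2_gt0 R)) //.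
by rewrite ler_ln ?posrE //; exact: lt_le_trans xy.
Qed.

Lemma log2_exp2 (R : realType) n : log2 (2 ^+ n) = n%:R :> R.
Proof.
by rewrite /log2 lnXn // -(mulr_natl (ln 2)) mulfK // gt_eqF // ln2_gt0.
Qed.

Lemma ln2_ge_half (R : realType) : 1 / 2 <= ln 2 :> R.
Proof.
have : ln (1 + - (1 / 2)) <= - (1 / 2) :> R by apply: le_ln1Dx; lra.
have -> : 1 + - (1 / 2) = 2^-1 :> R by lra.
by rewrite lnV ?posrE //; lra.
Qed.

Lemma log2_log2_lt (R : realType) (N : nat) t : 1 <= ln N%:R :> R ->
  ln N%:R < 2 ^+ t.+1 :> R -> log2 (log2 N%:R) <= t.+2%:R :> R.
Proof.
move=> L1 Lt; rewrite -(log2_exp2 R t.+2); have l2 := ln2_gt0 R; have h2 := ln2_ge_half R.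
apply: ler_log2; first by rewrite divr_gt0 //; lra.
rewrite /log2 ler_pdivrMr // exprS; move: Lt.
move: (2 ^+ t.+1) => p; nra.
Qed.

Lemma measurable_preimage_nat (R : realType) (d : measure_display)
    (T : measurableType d) (P : probability T R) (X : {RV P >-> nat}) (B : set nat) :
  measurable (X @^-1` B)%classic.
Proof. by rewrite -[X in measurable X]setTI; apply: measurable_funPT. Qed.

Theorem mainTheorem2 (R : realType) :
  exists (c : R) (N0 : nat), 0 < c /\
    forall (N : nat) (d : measure_display) (T : measurableType d)
      (P : probability T R) (X Y : {RV P >-> nat}),
      (N0 <= N)%N ->
      (forall t : T, (1 <= X t <= N)%N /\ (1 <= Y t <= N)%N) ->
      cond_entropy P (fun t => (X t : nat, Y t : nat)) (fun t => (X t * Y t)%N) = 0%E ->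
      ((c * log2 (log2 N%:R))%:E <=
        (2 * log2 N%:R)%:E - entropy P (fun t => (X t : nat, Y t : nat)))%E.
Proof.
(* For ln N >= 2^T0 the saving s = t / 33 is at least 34, hence s - 17 >= s / 2,
   while log2 (log2 N) <= t + 2 <= 35 s: this gives the constant 1 / 70. *)
pose T0 := (33 * 34)%N.
exists (70^-1), (Num.truncn (expR (2 ^+ T0) : R)).+1; split; first by rewrite invr_gt0.
move=> N d T P X Y N0N XYN H0.
have LT0 : 2 ^+ T0 <= ln N%:R :> R.
  rewrite -[leLHS]expRK ler_ln ?posrE ?expR_gt0 //; last first.
    by rewrite ltr0n; exact: leq_trans N0N.
  by apply: ltW; rewrite -truncn_lt_nat ?expR_ge0.
have N0 : (0 < N)%N by exact: leq_trans N0N.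
have L1 : 1 <= ln N%:R :> R.
  by apply: le_trans LT0; rewrite exprn_ege1 //; lra.
have [t /andP[tL Lt]] := dyadic_bracket R _ L1.
have T0t : (T0 <= t)%N.
  have : 2 ^+ T0 < 2 ^+ t.+1 :> R by exact: le_lt_trans Lt.
  by rewrite ltr_eXn2l ?ltnS //; lra.
pose s := (t %/ 33)%N.
have ts : (t < 33 * s.+1)%N by rewrite mulnC; exact: ltn_ceil.
have st : (33 * s <= t)%N by rewrite mulnC; exact: leq_divM.
have s34 : (34 <= s)%N by rewrite leq_divRL // mulnC.
pose Z t := (X t : nat, Y t : nat).
pose f (v : nat * nat) := (v.1 * v.2)%N.
have ZE v : (Z @^-1` [set v] = X @^-1` [set v.1] `&` Y @^-1` [set v.2])%classic.
  case: v => a b; apply/seteqP; split => z /=; first by case.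
  by move=> [<- <-].
have mZ v : measurable (Z @^-1` [set v])%classic.
  by rewrite ZE; apply: measurableI; exact: measurable_preimage_nat.
have mU u : measurable ((f \o Z) @^-1` [set u])%classic.
  have -> : ((f \o Z) @^-1` [set u] = \bigcup_a \bigcup_b
      (if (a * b == u)%N then Z @^-1` [set (a, b)] else set0))%classic.
    apply/seteqP; split => [z /= zu|z [a _ [b _]]].
      by exists (X z) => //; exists (Y z) => //; rewrite -zu eqxx.
    by case: eqP => // <- /= [<- <-].
  apply: bigcup_measurable => a _; apply: bigcup_measurable => b _.
  by case: ifP.
pose S0 := [seq (x, y) | x <- iota 1 N, y <- iota 1 N].
have uS0 : uniq S0.
  by apply: allpairs_uniq => [||[a b] [c e] _ _ []]; rewrite ?iota_uniq // => -> ->.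
have ZS0 z : Z z \in S0.
  have [Xz Yz] := XYN z.
  apply/allpairsPdep; exists (X z : nat), (Y z : nat).
  by rewrite !mem_iota; split => //; lia.
pose S := [seq v <- S0 | mass P Z v != 0].
have uS : uniq S by rewrite filter_uniq.
have boxS : all (box N) S.
  apply/allP => v; rewrite mem_filter => /andP[_ /allpairsPdep[x [y [+ + ->]]]].
  by rewrite !mem_iota /box /=; lia.
have supp v : mass P Z v != 0 -> v \in S.
  move=> v0; rewrite mem_filter v0 /=.
  have [//|vS0] := boolP (v \in S0); case/negP: v0; rewrite /mass.
  suff -> : (Z @^-1` [set v] = set0)%classic by rewrite measure0.
  by apply/seteqP; split => // z /= zv; move: vS0; rewrite -zv ZS0.
have tot : \sum_(v <- S) mass P Z v = 1.
  rewrite -(sum_mass R d T P _ Z S0) // big_filter.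
  rewrite [RHS](bigID (fun v => mass P Z v != 0)) /=.
  by rewrite [X in _ + X]big1 ?addr0 // => v /negPn /eqP.
have injS : {in S &, injective f}.
  move=> v w; rewrite !mem_filter => /andP[v0 _] /andP[w0 _].
  exact: (cond_entropy0_injective R d T P _ _ Z f mZ mU H0).
have cnt := injective_product_le R N S s t N0 uS boxS injS _ st.
have {}cnt := cnt (introT andP (conj tL Lt)).
have ent := entropy_le_log2_size R d T P _ Z S mZ uS supp tot.
have S1 : 0 < (size S)%:R :> R.
  rewrite ltr0n; case: (S) tot => //; rewrite big_nil => /eqP.
  by rewrite eq_sym oner_eq0.
have logS : log2 (size S)%:R <= 17 + 2 * log2 N%:R - s%:R :> R.
  apply: le_trans (ler_log2 R _ _ S1 cnt) _.
  have NN : 0 < N%:R :> R by rewrite ltr0n.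
  have p2 n : 0 < 2 ^+ n :> R by exact: exprn_gt0.
  rewrite -(log2_exp2 R 17) -(log2_exp2 R s) /log2.
  have p17 := p2 17%N; have ps := p2 s.
  have N2 : 0 < N%:R ^+ 2 :> R by exact: exprn_gt0.
  rewrite ln_div ?posrE ?mulr_gt0 // (lnM (x := 2 ^+ 17)) ?posrE //.
  by rewrite (lnXn 2 NN) -(mulr_natl (ln N%:R)) !mulrDl mulNr mulrA.
have ll := log2_log2_lt R N t L1 Lt.
apply: le_trans (leeB (lexx _) ent).
rewrite -EFinB lee_fin.
have ts' : t%:R + 1 <= 33 * (s%:R + 1) :> R.
  by rewrite !natr1 -natrM ler_nat.
have s34' : 34 <= s%:R :> R by rewrite ler_nat.
move: ll; rewrite -[t.+2%:R]natr1 -[t.+1%:R]natr1.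
lra.
Qed.
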